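(* One has $C_{\psi_t}=2$ for each $t\in(0,\infty)$, whereas $C_{\psi_\infty}=1$.
   Context: For $t\in(0,\infty)$ and $x\in\mathbb R$, $\psi_t(x):=x^2-(\max(0,|x|-t))^2$, and $\psi_\infty(x):=x^2$. For a continuously differentiable even function $f:\mathbb R\to\mathbb R$ with $f(0)=0$, $f>0$ on $\mathbb R\setminus\{0\}$, and $f'$ nondecreasing and concave on $[0,\infty)$ (all $\psi_t$ are such functions), $$C_f:=\sup_{0<x<s<\infty}\frac{f(x-s)-f(x)+sf'(x)}{f(s)}.$$ *)

(* Defs.v *)
From HB Require Import structures.
From mathcomp Require Import all_boot all_order all_algebra.
From mathcomp Require Import all_classical all_reals all_analysis.

Set Implicit Arguments.
Unset Strict Implicit.
Unset Printing Implicit Defensive.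

Import Order.TTheory GRing.Theory Num.Theory.
Import numFieldNormedType.Exports.

Local Open Scope classical_set_scope.
Local Open Scope ring_scope.

Definition psi (R : realType) (t x : R) : R :=
  x ^+ 2 - (Num.max 0 (`|x| - t)) ^+ 2.

Definition psi_infty (R : realType) (x : R) : R := x ^+ 2.

(* The supremum is taken in the extended reals, so that it exists without any
   boundedness argument. C f is intended only for continuously differentiable
   even f with f 0 = 0, f > 0 away from 0, and f' nondecreasing and concave on
   [0, +oo[; derive1 and the division are total, so the formula is stated for
   every f. *)
Definition C (R : realType) (f : R -> R) : \bar R :=
  ereal_sup [set y : \bar R | exists x s : R,
    [/\ 0 < x, x < s & y = ((f (x - s) - f x + s * derive1 f x) / f s)%:E]].

(* Main.v *)
Require Import Defs.
From mathcomp Require Import all_boot all_order all_algebra.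
From mathcomp Require Import all_classical all_reals all_analysis.
From mathcomp Require Import ring lra.

(** For [psi_infty] the numerator [(x - s)^2 - x^2 + 2 s x] is [s^2], so every
    quotient equals [1].

    For finite [t], the function [f = psi t] is a Huber function: [y^2] on
    [[-t, t]], continued by its tangent lines.  Its derivative on the positive
    axis is [2 min(x, t)], and its second derivative lies between [0] and [2], so
    that
      [0 <= f y - f x - (y - x) f' x <= (y - x)^2]   ([psi_taylor]).
    The upper bound identifies the derivative; the lower bound is convexity.

    The upper bound [C f <= 2] ([psi_quotient_le2]) splits the numerator into
    two terms, each at most [f s].  First, [f (x - s) <= f s] since
    [|x - s| <= s].  Second, [s f' x - f x <= f x + (s - x) f' x <= f s], where
    the first inequality is [x f' x <= 2 f x] (a consequence of concavity of
    [f']) and the second one is convexity.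

    The value [2] is approached, but not attained, with [x] fixed in the linear
    region of [f] and [s] going to infinity: both [f (x - s)] and [s f' x] are
    then equivalent to [2 t s], and so is [f s].  With [x = 2 t] the quotient
    is exactly [(4 s - 8 t) / (2 s - t)]. *)

Import Order.TTheory GRing.Theory Num.Theory.
Import numFieldNormedType.Exports.

Local Open Scope ring_scope.

(** Dividing the quadratic error by [y - x = h] bounds the distance from the
    difference quotient to [l] by [|h|]. *)
Lemma derive1_quadratic_error (R : realType) (f : R -> R) (x l : R) :
  (forall y, `|f y - f x - (y - x) * l| <= (y - x) ^+ 2) -> derive1 f x = l.
Proof.
move=> Hf; apply: cvg_lim => //.
apply/cvgrPdist_le => e e0.
near=> h.
have h0 : h != 0 by near: h; exact: nbhs_dnbhs_neq.
have he : `|h| <= e.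
  by near: h; apply: dnbhs0_le.
apply: le_trans he.
have -> : l - h^-1 *: (f (h + x) - f x)
    = - (h^-1 * (f (h + x) - f x - (h + x - x) * l)).
  by rewrite /GRing.scale /=; field.
rewrite normrN normrM normfV ler_pdivrMl ?normr_gt0//.
apply: le_trans (Hf _) _.
by rewrite addrK -normrM ger0_norm -?expr2 ?sqr_ge0.
Unshelve. all: by end_near. Qed.

Lemma psi_quadratic {R : realType} {t x : R} : `|x| <= t -> psi t x = x ^+ 2.
Proof.
by move=> xt; rewrite /psi max_l ?subr_le0// expr0n/= subr0.
Qed.

Lemma psi_linear {R : realType} {t x : R} :
  t <= `|x| -> psi t x = 2 * t * `|x| - t ^+ 2.
Proof.
move=> xt; rewrite /psi max_r ?subr_ge0// -(real_normK (num_real x)); ring.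
Qed.

Lemma psi_gt0 (R : realType) (t x : R) : 0 < t -> 0 < x -> 0 < psi t x.
Proof.
move=> t0 x0; have xE : `|x| = x by rewrite gtr0_norm.
by have [xt|/ltW xt] := leP x t;
  [rewrite psi_quadratic ?xE// | rewrite psi_linear ?xE//]; nra.
Qed.

Lemma psi_le (R : realType) (t x y : R) : 0 < t ->
  `|x| <= `|y| -> psi t x <= psi t y.
Proof.
move=> t0 xy.
have [yt|/ltW yt] := leP `|y| t.
  rewrite !psi_quadratic ?(le_trans xy)//.
  rewrite -(real_normK (num_real x)) -(real_normK (num_real y)).
  by rewrite lerXn2r ?nnegrE.
rewrite (psi_linear yt); have [xt|/ltW xt] := leP `|x| t.
  rewrite psi_quadratic// -(real_normK (num_real x)).
  by have := normr_ge0 x; nra.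
by rewrite psi_linear//; nra.
Qed.

(** The middle term is the remainder of the first-order expansion of a function
    whose second derivative is [2] on [(-t, t)] and [0] outside [[-t, t]]. *)
Lemma psi_taylor {R : realType} {t x : R} (y : R) : 0 < t -> 0 < x ->
  0 <= psi t y - psi t x - (y - x) * (2 * Num.min x t) <= (y - x) ^+ 2.
Proof.
move=> t0 x0; have xE : `|x| = x by rewrite gtr0_norm.
(* In each region both inequalities are combinations of the squares and
   products of nonnegative factors supplied to the arithmetic solver. *)
have [xt|/ltW xt] := leP x t; have [yt|/ltW yt] := leP `|y| t.
- rewrite !psi_quadratic ?xE//.
  by have := sqr_ge0 (y - x); lra.
- rewrite psi_linear// psi_quadratic ?xE//.
  move: yt; have [y0|/ltW y0] := leP 0 y;
    rewrite ?(ger0_norm y0) ?(ler0_norm y0) => yt.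
    have : 0 <= (t - x) * (y - t) by apply: mulr_ge0; lra.
    by have := sqr_ge0 (t - x); have := sqr_ge0 (y - t); lra.
  have : 0 <= (t + x) * (- y - t) by apply: mulr_ge0; lra.
  by have := sqr_ge0 (t + x); have := sqr_ge0 (y + t); lra.
- rewrite psi_quadratic// psi_linear ?xE//.
  have yt' : y <= t by apply: le_trans (ler_norm y) yt.
  have : 0 <= (x - t) * (t - y) by apply: mulr_ge0; lra.
  by have := sqr_ge0 (x - t); have := sqr_ge0 (y - t); lra.
- rewrite !psi_linear ?xE//.
  move: yt; have [y0|/ltW y0] := leP 0 y;
    rewrite ?(ger0_norm y0) ?(ler0_norm y0) => yt.
    by have := sqr_ge0 (y - x); lra.
  have : 0 <= (x - t) * - y by apply: mulr_ge0; lra.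
  have : 0 <= t * - y by apply: mulr_ge0; lra.
  by have := sqr_ge0 (x + y); lra.
Qed.

Lemma derive1_psi (R : realType) (t x : R) : 0 < t -> 0 < x ->
  derive1 (psi t) x = 2 * Num.min x t.
Proof.
move=> t0 x0; apply: derive1_quadratic_error => y.
by have /andP[? ?] := psi_taylor y t0 x0; rewrite ger0_norm.
Qed.

(** Concavity of the derivative, in integrated form: since [f' 0 = 0], the
    chord of [f'] on [[0, x]] lies below its graph, so the area [f x] under the
    graph is at least the area [x f' x / 2] of the triangle under the chord. *)
Lemma psi_derive_le {R : realType} {t x : R} : 0 < t -> 0 < x ->
  x * (2 * Num.min x t) <= 2 * psi t x.
Proof.
move=> t0 x0; have xE : `|x| = x by rewrite gtr0_norm.
by have [xt|/ltW xt] := leP x t;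
  [rewrite psi_quadratic ?xE// | rewrite psi_linear ?xE//]; nra.
Qed.

Lemma psi_quotient_le2 (R : realType) (t x s : R) : 0 < t -> 0 < x -> x < s ->
  (psi t (x - s) - psi t x + s * derive1 (psi t) x) / psi t s <= 2.
Proof.
move=> t0 x0 xs; have s0 := lt_trans x0 xs.
rewrite ler_pdivrMr ?psi_gt0// derive1_psi//.
have even_mono : psi t (x - s) <= psi t s.
  by apply: psi_le => //; rewrite ltr0_norm ?gtr0_norm//; lra.
have /andP[convex _] := psi_taylor s t0 x0.
have := psi_derive_le t0 x0; lra.
Qed.

Lemma psi_quotient_linear (R : realType) (t s : R) : 0 < t -> 3 * t <= s ->
  (psi t (2 * t - s) - psi t (2 * t) + s * derive1 (psi t) (2 * t)) / psi t s
  = (4 * s - 8 * t) / (2 * s - t).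
Proof.
move=> t0 ts.
have n1 : `|2 * t - s| = s - 2 * t by rewrite ler0_norm; lra.
have n2 : `|2 * t| = 2 * t by rewrite ger0_norm; lra.
have n3 : `|s| = s by rewrite ger0_norm; lra.
rewrite derive1_psi//; last lra.
rewrite min_r; last lra.
rewrite !psi_linear ?n1 ?n2 ?n3; try lra.
by field; apply/andP; split; apply: lt0r_neq0; nra.
Qed.

Lemma C_psi (R : realType) (t : R) : 0 < t -> C (psi t) = 2%:E.
Proof.
move=> t0; apply/eqP; rewrite eq_le; apply/andP; split.
  apply: ge_ereal_sup => _ [x [s [x0 xs ->]]].
  by rewrite lee_fin psi_quotient_le2.
apply/lee_subgt0Pr => e e0.
(* The quotient is [2 - 6 t / (2 s - t)], so the error is at most [e] as soon
   as [2 s - t] is at least [6 t / e]. *)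
pose s := 3 * t + 3 * t / e.
have te0 : 0 < t / e by rewrite divr_gt0.
apply: (@le_trans _ _ ((4 * s - 8 * t) / (2 * s - t))%:E); last first.
  apply: ereal_sup_ubound; exists (2 * t), s; split; [lra | rewrite /s; lra |].
  by rewrite psi_quotient_linear// /s; lra.
have se : s * e = 3 * t * e + 3 * t.
  by rewrite /s; field; exact: lt0r_neq0.
rewrite -EFinB lee_fin ler_pdivlMr; last by rewrite /s; lra.
nra.
Qed.

Lemma derive1_psi_infty (R : realType) (x : R) :
  derive1 (@psi_infty R) x = 2 * x.
Proof.
apply: derive1_quadratic_error => y; rewrite /psi_infty.
have -> : y ^+ 2 - x ^+ 2 - (y - x) * (2 * x) = (y - x) ^+ 2 by ring.
by rewrite ger0_norm ?sqr_ge0.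
Qed.

Lemma C_psi_infty (R : realType) : C (@psi_infty R) = 1%:E.
Proof.
have quotient1 (x s : R) : 0 < x -> x < s ->
    (psi_infty (x - s) - psi_infty x + s * derive1 (@psi_infty R) x)
      / psi_infty s = 1.
  move=> x0 xs; rewrite derive1_psi_infty /psi_infty; field.
  by apply: lt0r_neq0; lra.
apply/eqP; rewrite eq_le; apply/andP; split.
  by apply: ge_ereal_sup => _ [x [s [x0 xs ->]]]; rewrite quotient1.
apply: ereal_sup_ubound; exists 1, 2; split; [lra | lra |].
by rewrite quotient1//; lra.
Qed.

Theorem proposition1p6 (R : realType) :
  (forall t : R, 0 < t -> C (psi t) = 2%:E) /\ C (@psi_infty R) = 1%:E.
Proof.
by split; [exact: C_psi | exact: C_psi_infty].
Qed.
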